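(* In the split Grothendieck ring $K_0(\operatorname{Kar}(\mathbf{Sp}_q))$ of the Karoubi envelope of the $A_2$ spider one has $$\langle P_{(1,1)}\rangle=XY-1,$$ where $P_{(1,1)}=({+}{-},\,P_{{+}{-}}^{{+}{-}})$, $X=\langle({+},\mathbf 1_{+})\rangle$ and $Y=\langle({-},\mathbf 1_{-})\rangle$.
   Context: **The $A_2$ spider.** Let $[n]=(q^{n/2}-q^{-n/2})/(q^{1/2}-q^{-1/2})$. $\mathbf{Sp}_q$ is the following $\mathbb C(q^{1/6})$-linear monoidal category. Objects are finite (possibly empty) sequences of signs $+,-$; tensor product of objects is concatenation. A web from $\epsilon$ (length $m$) to $\delta$ (length $n$) is a directed planar graph in $[0,1]\times[0,1]$, up to boundary-fixing isotopy, with $m$ univalent vertices on the bottom side, $n$ univalent vertices on the top side, and all other vertices interior, trivalent, and either sinks or sources (vertexless closed loops are allowed in webs). The edge at the $i$-th bottom point is directed away from that point if $\epsilon(i)=+$ and toward it if $\epsilon(i)=-$; the edge at the $j$-th top point is directed toward that point if $\delta(j)=+$ and away from it if $\delta(j)=-$. A basis web is a web without closed loops in which every internal face (one not meeting the boundary of the square) has at least six sides. $\mathbf{Sp}_q(\epsilon,\delta)$ is the vector space with basis the basis webs from $\epsilon$ to $\delta$. Composition $GF$ stacks $G$ on top of $F$ and reduces to basis webs by the local relations: a closed loop (either orientation) equals $[3]$ times its removal; an internal $2$-gon equals $[2]$ times a single edge; an internal $4$-gon equals the sum of the two webs obtained by replacing it with two disjoint arcs joining its four external legs in the two planar, orientation-compatible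 ways. The identity $\mathbf 1_\epsilon$ is given by vertical parallel edges; tensor product of webs is horizontal juxtaposition. **The clasp.** $b^{+-}\colon\emptyset\to{+}{-}$ and $d_{+-}\colon{+}{-}\to\emptyset$ are the single arcs (cup, cap), and $P_{{+}{-}}^{{+}{-}}=\mathbf 1_{{+}{-}}-\frac1{[3]}b^{+-}d_{+-}$, an idempotent. **Karoubi envelope and $K_0$.** Objects of $\operatorname{Kar}(\mathcal A)$ are pairs $(Z,f)$ with $f\in\operatorname{End}(Z)$ idempotent; morphisms $(Z,f)\to(W,g)$ are morphisms $\phi\colon Z\to W$ of $\mathcal A$ with $g\phi f=\phi$; $(Z,f)\otimes(W,g)=(Z\otimes W,f\otimes g)$. Finite (formal) direct sums are adjoined so that $\operatorname{Kar}(\mathbf{Sp}_q)$ is additive. $K_0$ of an additive monoidal category is the ring generated by isomorphism classes $\langle Z\rangle$ modulo $\langle Z_1\oplus Z_2\rangle=\langle Z_1\rangle+\langle Z_2\rangle$, with product $\langle Z\otimes W\rangle=\langle Z\rangle\langle W\rangle$ and unit $1$ the class of the empty sequence with the empty web. *)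

(* Defs.v *)
From Stdlib Require List.
From HB Require Import structures.
From mathcomp Require Import all_boot all_order all_algebra.
From mathcomp Require Import boolp classical_sets reals complex finmap.
From mathcomp Require Import fraction.
From mathcomp.multinomials Require Import monalg.

Set Implicit Arguments.
Unset Strict Implicit.
Unset Printing Implicit Defensive.

Import GRing.Theory.
Local Open Scope ring_scope.
Local Open Scope quotient_scope.

(* A sign word; [true] is + and [false] is -. *)
Definition word := seq bool.

(* Webs up to isotopy are encoded as combinatorial maps.  Contracting the
   outside of the square to a point turns a web into a map on the sphere whose
   vertices are the internal vertices and, if there are boundary points, the
   point at infinity.  The half-edges are the boundary points (bottom ones in
   the left summand, top ones in the right summand) and the pairs (x, a), where
   x is an internal vertex and a : 'I_3 numbers the half-edges at x
   counterclockwise. *)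
Definition hedge (e d : word) (V : finType) : finType :=
  (('I_(size e) + 'I_(size d)) + V * 'I_3)%type.

Section Prewebs.
Variables e d : word.

Notation bpoint := ('I_(size e) + 'I_(size d))%type.

(* [source x] tells whether the internal vertex x is a source or a sink, [mate]
   exchanges the two halves of each edge and [loops] is the number of vertexless
   closed loops.  Vertexless loops, and more generally components not
   attached to the boundary, are recorded without the face they lie in: basis
   webs have no such component, and the local relations evaluate each of
   them to a scalar independent of its position. *)
Record preweb (V : finType) := Preweb {
  source : {ffun V -> bool};
  mate : {ffun hedge e d V -> hedge e d V};
  loops : nat }.

Definition bbot V (i : 'I_(size e)) : hedge e d V := inl (inl i).
Definition btop V (j : 'I_(size d)) : hedge e d V := inl (inr j).

(* Counterclockwise around the point at infinity is clockwise along the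
   boundary of the square. *)
Definition boundary : seq bpoint :=
  [seq inr j | j <- enum 'I_(size d)] ++ rev [seq inl i | i <- enum 'I_(size e)].

Definition turn V (x : hedge e d V) : hedge e d V :=
  match x with
  | inl p => inl (next boundary p)
  | inr (y, a) => inr (y, ordS a)
  end.

Section OneWeb.
Variables (V : finType) (w : preweb V).

(* Whether the edge containing x is directed away from the endpoint x. *)
Definition is_tail (x : hedge e d V) : bool :=
  match x with
  | inl (inl i) => nth true e i
  | inl (inr j) => ~~ nth true d j
  | inr (y, _) => source w y
  end.

(* The orbits of [face_step] are the boundary walks of the faces. *)
Definition face_step (x : hedge e d V) : hedge e d V := turn (mate w x).

Definition internal_face (x : hedge e d V) : Prop :=
  forall y, fconnect face_step x y -> exists z, y = inr z.

Definition planar : Prop :=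
  (fcard (@turn V) predT + fcard (mate w) predT + fcard face_step predT =
   #|hedge e d V| +
   2 * n_comp [rel x y | (turn x == y) || (mate w x == y)] predT)%N.

Definition is_web : Prop :=
  [/\ involutive (mate w),
      forall x, is_tail (mate w x) = ~~ is_tail x
    & planar].

Definition is_basis : Prop :=
  [/\ is_web, loops w = 0%N
    & forall x, internal_face x -> (6 <= order face_step x)%N].

Definition unloop : preweb V := Preweb (source w) (mate w) (loops w).-1.
End OneWeb.

(* The boundary points are fixed one by one and the cyclic orders preserved. *)
Definition web_sim V1 V2 (w1 : preweb V1) (w2 : preweb V2) : Prop :=
  exists h : hedge e d V1 -> hedge e d V2,
    [/\ bijective h,
        forall p, h (inl p) = inl p,
        forall x, h (turn x) = turn (h x),
        forall x, is_tail w2 (h x) = is_tail w1 x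
      & forall x, h (mate w1 x) = mate w2 (h x)].

Definition web_iso V1 V2 (w1 : preweb V1) (w2 : preweb V2) : Prop :=
  loops w1 = loops w2 /\ web_sim w1 w2.

Definition preweb_code V (w : preweb V) := (source w, mate w, loops w).
Definition preweb_decode V c : preweb V := Preweb c.1.1 c.1.2 c.2.
Lemma preweb_codeK V : cancel (@preweb_code V) (@preweb_decode V).
Proof. by case. Qed.
HB.instance Definition _ V := Choice.copy (preweb V) (can_type (@preweb_codeK V)).

Definition numweb := {k : nat & preweb 'I_k}.
Definition basis_web := {w : numweb | `[< is_basis (tagged w) >]}.
Definition bw (b : basis_web) : preweb 'I_(tag (val b)) := tagged (val b).
End Prewebs.

Section Isotopy.
Variables e d : word.

Lemma web_sim_refl V (w : preweb e d V) : web_sim w w.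
Proof. by exists id; split=> //; exists id. Qed.

Lemma web_sim_sym V1 V2 (w1 : preweb e d V1) (w2 : preweb e d V2) :
  web_sim w1 w2 -> web_sim w2 w1.
Proof.
case=> h [[g hK gK] hb ht hs hm]; exists g; split.
- by exists h.
- by move=> p; rewrite -[inl p in LHS]hb hK.
- by move=> x; rewrite -{1}[x]gK -ht hK.
- by move=> x; rewrite -hs gK.
- by move=> x; rewrite -{1}[x]gK -hm hK.
Qed.

Lemma web_sim_trans V1 V2 V3 (w1 : preweb e d V1) (w2 : preweb e d V2)
    (w3 : preweb e d V3) : web_sim w1 w2 -> web_sim w2 w3 -> web_sim w1 w3.
Proof.
case=> h [hB hb ht hs hm] [g [gB gb gt gs gm]]; exists (g \o h); split=> /=.
- exact: bij_comp.
- by move=> p; rewrite hb gb.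
- by move=> x; rewrite ht gt.
- by move=> x; rewrite gs hs.
- by move=> x; rewrite hm gm.
Qed.

Definition basis_iso : rel (basis_web e d) :=
  fun b c => `[< web_iso (bw b) (bw c) >].

Lemma basis_iso_refl : reflexive basis_iso.
Proof. by move=> b; apply/asboolP; split=> //; apply: web_sim_refl. Qed.

Lemma basis_iso_sym : symmetric basis_iso.
Proof.
suff H b c : basis_iso b c -> basis_iso c b by move=> b c; apply/idP/idP; apply: H.
by case/asboolP=> E S; apply/asboolP; split; last exact: web_sim_sym.
Qed.

Lemma basis_iso_trans : transitive basis_iso.
Proof.
move=> c b a /asboolP[E S] /asboolP[E' S']; apply/asboolP.
by split; [rewrite E | apply: web_sim_trans S S'].
Qed.

Canonical basis_iso_equiv :=
  EquivRel basis_iso basis_iso_refl basis_iso_sym basis_iso_trans.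
Definition basis_class := {eq_quot basis_iso}.
HB.instance Definition _ := Choice.on basis_class.
HB.instance Definition _ := EqQuotient.on basis_class.
End Isotopy.

(* Reconnecting edges.  T is a set of half-edges with edges given by [m], U the
   set of half-edges surviving in the new web, and [arc] joins pairs of
   half-edges that do not survive.  Paths made of edges and arcs between two
   surviving half-edges become the new edges; the closed ones are new loops. *)
Section Splice.
Variables (T U : finType) (kept : U -> T) (m : T -> T) (arc : rel T).

Definition glue : rel T := [rel x y | (m x == y) || arc x y].

Definition splice_mate : {ffun U -> U} :=
  [ffun u => odflt u
     [pick u' | (u' != u) && connect glue (kept u) (kept u')]].

Definition splice_loops : nat :=
  n_comp glue [pred t | [exists s, arc t s] &&
                        [forall u, ~~ connect glue (kept u) t]].
End Splice.

(* [stack g f] puts g on top of f. *)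
Section Stack.
Variables (c e d : word) (V W : finType).
Variables (g : preweb e d W) (f : preweb c e V).

Definition stack_kept (x : hedge c d (V + W)%type) : hedge c e V + hedge e d W :=
  match x with
  | inl (inl i) => inl (bbot e V i)
  | inl (inr j) => inr (btop e W j)
  | inr (inl y, a) => inl (inr (y, a))
  | inr (inr y, a) => inr (inr (y, a))
  end.

Definition stack_mate (x : hedge c e V + hedge e d W) : hedge c e V + hedge e d W :=
  match x with
  | inl y => inl (mate f y)
  | inr y => inr (mate g y)
  end.

Definition stack_arc : rel (hedge c e V + hedge e d W) := fun x y =>
  match x, y with
  | inl (inl (inr i)), inr (inl (inl j)) => i == j
  | inr (inl (inl i)), inl (inl (inr j)) => i == j
  | _, _ => false
  end.

Definition stack : preweb c d (V + W)%type := Preweb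
  [ffun x => match x with inl y => source f y | inr y => source g y end]
  (splice_mate stack_kept stack_mate stack_arc)
  (loops f + loops g + splice_loops stack_kept stack_mate stack_arc).
End Stack.

Section Juxtapose.
Variables (e1 d1 e2 d2 : word) (V1 V2 : finType).
Variables (w1 : preweb e1 d1 V1) (w2 : preweb e2 d2 V2).

Definition lpos (s t : word) (i : 'I_(size s)) : 'I_(size (s ++ t)) :=
  cast_ord (esym (size_cat s t)) (lshift _ i).
Definition rpos (s t : word) (i : 'I_(size t)) : 'I_(size (s ++ t)) :=
  cast_ord (esym (size_cat s t)) (rshift _ i).

Definition lhalf (x : hedge e1 d1 V1) : hedge (e1 ++ e2) (d1 ++ d2) (V1 + V2)%type :=
  match x with
  | inl (inl i) => inl (inl (lpos e2 i))
  | inl (inr j) => inl (inr (lpos d2 j))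
  | inr (y, a) => inr (inl y, a)
  end.
Definition rhalf (x : hedge e2 d2 V2) : hedge (e1 ++ e2) (d1 ++ d2) (V1 + V2)%type :=
  match x with
  | inl (inl i) => inl (inl (rpos e1 i))
  | inl (inr j) => inl (inr (rpos d1 j))
  | inr (y, a) => inr (inr y, a)
  end.

Definition juxtapose : preweb (e1 ++ e2) (d1 ++ d2) (V1 + V2)%type := Preweb
  [ffun x => match x with inl y => source w1 y | inr y => source w2 y end]
  [ffun x => if [pick y | lhalf y == x] is Some y then lhalf (mate w1 y)
             else if [pick y | rhalf y == x] is Some y then rhalf (mate w2 y)
             else x]
  (loops w1 + loops w2).
End Juxtapose.

(* Removal of a face with 2 or 4 sides.  The vertices of the face containing x
   are deleted; [leg i] is the half-edge pointing out of the face at its i-th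
   vertex.  Sources and sinks alternate around a face, so the two
   orientation-compatible ways of reconnecting the legs of a 4-gon are the two
   ways of pairing cyclically adjacent legs. *)
Section Surgery.
Variables (e d : word) (V : finType) (w : preweb e d V) (x : hedge e d V).

Definition off_face (y : V) : bool :=
  [forall a : 'I_3, ~~ fconnect (face_step w) x (inr (y, a))].

Definition surgery_kept (u : hedge e d {y : V | off_face y}) : hedge e d V :=
  match u with
  | inl p => inl p
  | inr (y, a) => inr (val y, a)
  end.

Definition surgery (arc : rel (hedge e d V)) : preweb e d {y : V | off_face y} :=
  Preweb [ffun y => source w (val y)]
         (splice_mate surgery_kept (mate w) arc)
         (loops w + splice_loops surgery_kept (mate w) arc).

Definition leg (i : nat) : hedge e d V := turn (iter i (face_step w) x).

Definition leg_arc (i j : nat) : rel (hedge e d V) := fun y z =>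
  ((y == leg i) && (z == leg j)) || ((y == leg j) && (z == leg i)).

Definition bigon_edge := surgery (leg_arc 0 1).
Definition square_arcs1 :=
  surgery (fun y z => leg_arc 0 1 y z || leg_arc 2 3 y z).
Definition square_arcs2 :=
  surgery (fun y z => leg_arc 1 2 y z || leg_arc 3 0 y z).
End Surgery.

Section BasicWebs.
Definition idweb (e : word) : preweb e e 'I_0 := Preweb [ffun => true]
  [ffun x => match x with
             | inl (inl i) => btop e _ i
             | inl (inr i) => bbot e _ i
             | inr y => inr y
             end] 0.

(* The arc from [::] to +- and the arc from +- to [::]. *)
Definition cupweb : preweb [::] [:: true; false] 'I_0 := Preweb [ffun => true]
  [ffun x => match x with inl (inr i) => inl (inr (rev_ord i)) | _ => x end] 0.
Definition capweb : preweb [:: true; false] [::] 'I_0 := Preweb [ffun => true]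
  [ffun x => match x with inl (inl i) => inl (inl (rev_ord i)) | _ => x end] 0.
End BasicWebs.

Section Spider.
(* [v] stands for q^(1/6). *)
Variables (K : fieldType) (v : K).

Definition qint (n : nat) : K :=
  (v ^+ (3 * n) - v ^- (3 * n)) / (v ^+ 3 - v ^- 3).

Definition hom (e d : word) := {malg K[basis_class e d]}.

Definition basis_vec e d (b : basis_web e d) : hom e d :=
  << \pi_(basis_class e d) b >>.

Inductive reduces e d : forall V : finType, preweb e d V -> hom e d -> Prop :=
| reduces_basis V (w : preweb e d V) (b : basis_web e d) :
    web_iso w (bw b) -> reduces w (basis_vec b)
| reduces_loop V (w : preweb e d V) h :
    (0 < loops w)%N -> reduces (unloop w) h -> reduces w (qint 3 *: h)
| reduces_bigon V (w : preweb e d V) x h :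
    internal_face w x -> order (face_step w) x = 2%N ->
    reduces (bigon_edge w x) h -> reduces w (qint 2 *: h)
| reduces_square V (w : preweb e d V) x h1 h2 :
    internal_face w x -> order (face_step w) x = 4%N ->
    reduces (square_arcs1 w x) h1 -> reduces (square_arcs2 w x) h2 ->
    reduces w (h1 + h2).

(* By Kuperberg's confluence theorem a planar web reduces to exactly one
   combination of basis webs; [reduct] names it. *)
Definition reduct e d V (w : preweb e d V) : hom e d :=
  xget 0 [set h | reduces w h]%classic.

Definition linext (S : choiceType) (U : lmodType K) (F : S -> U)
    (g : {malg K[S]}) : U := \sum_(x <- enum_fset (msupp g)) g@_x *: F x.

Definition bilin (S T : choiceType) (U : lmodType K) (op : S -> T -> U)
    (g : {malg K[S]}) (f : {malg K[T]}) : U :=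
  linext (fun x => linext (op x) f) g.

Definition hcomp c e d (g : hom e d) (f : hom c e) : hom c d :=
  @bilin (basis_class e d) (basis_class c e) {malg K[basis_class c d]}
    (fun x y => reduct (stack (bw (repr x)) (bw (repr y)))) g f.

Definition tensor e1 d1 e2 d2 (f : hom e1 d1) (g : hom e2 d2) :
    hom (e1 ++ e2) (d1 ++ d2) :=
  @bilin (basis_class e1 d1) (basis_class e2 d2)
    {malg K[basis_class (e1 ++ e2) (d1 ++ d2)]}
    (fun x y => reduct (juxtapose (bw (repr x)) (bw (repr y)))) f g.

Definition idhom e : hom e e := reduct (idweb e).

Definition pm : word := [:: true; false].
Definition cup : hom [::] pm := reduct cupweb.
Definition cap : hom pm [::] := reduct capweb.
Definition clasp : hom pm pm := idhom pm - (qint 3)^-1 *: hcomp cup cap.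

Section Linext.
Variables (S : choiceType) (U : lmodType K).
Implicit Types (F : S -> U) (g h : {malg K[S]}).

Lemma linextE (D : {fset S}) F g : (msupp g `<=` D)%fset ->
  linext F g = \sum_(x <- enum_fset D) g@_x *: F x.
Proof.
move=> gD; apply: big_fset_incl => // x _ xg.
by rewrite mcoeff_outdom ?scale0r.
Qed.

Lemma linextP F a g h : linext F (a *: g + h) = a *: linext F g + linext F h.
Proof.
pose D := (msupp g `|` msupp h)%fset.
have gD : (msupp g `<=` D)%fset by exact: fsubsetUl.
have hD : (msupp h `<=` D)%fset by exact: fsubsetUr.
rewrite (linextE F gD) (linextE F hD) (@linextE D).
  rewrite scaler_sumr -big_split /=; apply: eq_bigr => x _.
  by rewrite mcoeffD mcoeffZ scalerDl scalerA.
apply: fsubset_trans (msuppD_le _ _) _.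
by rewrite fsubUset hD (fsubset_trans (msuppZ_le _ _) gD).
Qed.

Lemma linextPf F F' a g :
  linext (fun x => a *: F x + F' x) g = a *: linext F g + linext F' g.
Proof.
rewrite /linext scaler_sumr -big_split /=; apply: eq_bigr => x _.
by rewrite scalerDr !scalerA mulrC.
Qed.

Lemma linextU F x : linext F << x >> = F x.
Proof.
rewrite (@linextE [fset x]%fset) ?msuppU_le // big_seq_fset1 mcoeffU eqxx.
by rewrite scale1r.
Qed.
End Linext.

Lemma compPl c e d a (g g' : hom e d) (f : hom c e) :
  hcomp (a *: g + g') f = a *: hcomp g f + hcomp g' f.
Proof. exact: linextP. Qed.

Lemma bilinPr (S T : choiceType) (U : lmodType K) (op : S -> T -> U) a
    (g : {malg K[S]}) (f f' : {malg K[T]}) :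
  bilin op g (a *: f + f') = a *: bilin op g f + bilin op g f'.
Proof.
rewrite /bilin (_ : (fun x => linext (op x) (a *: f + f')) =
  fun x => a *: linext (op x) f + linext (op x) f'); first exact: linextPf.
by apply/funext => x; apply: linextP.
Qed.

Lemma compPr c e d a (g : hom e d) (f f' : hom c e) :
  hcomp g (a *: f + f') = a *: hcomp g f + hcomp g f'.
Proof. exact: bilinPr. Qed.

Lemma comp0l c e d (f : hom c e) : hcomp (0 : hom e d) f = 0.
Proof. by rewrite /hcomp /bilin /linext msupp0 big_nil. Qed.

Lemma comp0r c e d (g : hom e d) : hcomp g (0 : hom c e) = 0.
Proof.
rewrite /hcomp /bilin /linext big1 // => x _.
by rewrite msupp0 big_nil scaler0.
Qed.

Lemma reduces_flat e d V (w : preweb e d V) h : (V -> False) -> reduces w h ->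
  exists2 b, web_sim w (bw b) & h = qint 3 ^+ loops w *: basis_vec b.
Proof.
move=> V0 R; elim: R V0 => {V w h} [V w b [E S]|V w h w0 _ IH|V w x h xi _ _ _|
    V w x h1 h2 xi _ _ _ _ _] V0.
- exists b => //; rewrite E.
  have /asboolP[_ -> _] := valP b.
  by rewrite expr0 scale1r.
- have [b S ->] := IH V0; exists b; first exact: S.
  have -> : loops w = (loops (unloop w)).+1 by rewrite /= prednK.
  by rewrite exprS -scalerA.
- by have [[y a] _] := xi x (connect0 _ _); case: (V0 y).
- by have [[y a] _] := xi x (connect0 _ _); case: (V0 y).
Qed.

Lemma basis_vec_sim e d (b c : basis_web e d) :
  web_sim (bw b) (bw c) -> basis_vec b = basis_vec c.
Proof.
move=> S; have bc : b = c %[mod basis_class e d].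
  apply/eqmodP/asboolP; split; last exact: S.
  have /asboolP[_ E _] := valP b; have /asboolP[_ E' _] := valP c.
  by rewrite /bw E E'.
by rewrite /basis_vec bc.
Qed.

Lemma reduct_flat e d V (w : preweb e d V) b : (V -> False) ->
  web_sim w (bw b) -> reduct w = qint 3 ^+ loops w *: basis_vec b.
Proof.
move=> V0 S; apply: xget_unique => [|h /(reduces_flat V0)[c S' ->]]; last first.
  by rewrite (basis_vec_sim (web_sim_trans (web_sim_sym S') S)).
rewrite /=; have [n E] : {n | n = loops w} by exists (loops w).
rewrite -E; elim: n w E S => [|n IH] w E S.
  rewrite expr0 scale1r; apply: reduces_basis; split=> //.
  by have /asboolP[_ -> _] := valP b.
rewrite exprS -scalerA; apply: reduces_loop; first by rewrite -E.
by apply: IH; rewrite //= -E.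
Qed.

Lemma reduct_flat0 e d V (w : preweb e d V) : (V -> False) ->
  (forall b, ~ web_sim w (bw b)) -> reduct w = 0.
Proof. by move=> V0 N; apply: xgetPN => h /(reduces_flat V0)[b /N]. Qed.

Lemma reduct_sim e d V1 V2 (w1 : preweb e d V1) (w2 : preweb e d V2) n :
  (V1 -> False) -> (V2 -> False) -> web_sim w1 w2 ->
  loops w1 = (n + loops w2)%N -> reduct w1 = qint 3 ^+ n *: reduct w2.
Proof.
move=> V10 V20 S E.
have [[b S2]|N] := pselect (exists b, web_sim w2 (bw b)).
  rewrite (reduct_flat V20 S2) (reduct_flat V10 (web_sim_trans S S2)).
  by rewrite E exprD scalerA.
rewrite !reduct_flat0 ?scaler0 // => b S2; apply: N; exists b => //.
exact: web_sim_trans (web_sim_sym S) S2.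
Qed.

Lemma comp_basis c e d (b : basis_web e d) (b' : basis_web c e) :
  hcomp (basis_vec b) (basis_vec b') =
  reduct (stack (bw (repr (\pi_(basis_class e d) b)))
                (bw (repr (\pi_(basis_class c e) b')))).
Proof. by rewrite /hcomp /bilin /basis_vec !linextU. Qed.

Lemma flat_repr e d (w : preweb e d 'I_0) (b : basis_web e d) :
  loops w = 0%N -> web_sim w (bw b) ->
  val (repr (\pi_(basis_class e d) b)) = existT _ 0 w.
Proof.
set c := repr _ => w0 S.
have /asboolP[E T]: basis_iso c b by apply/eqmodP; rewrite /c reprK.
have {S T} S: web_sim w (bw c) := web_sim_trans S (web_sim_sym T).
have /asboolP[_ c0 _] := valP c.
move: S c0; rewrite /bw; case: (val c) => k x /= [h [[g hK gK] hb _ hs hm]] x0.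
case: k => [|k] in x h g hK gK hb hs hm x0 *; last first.
  move: (gK (inr (ord0, ord0))); case: (g _) => [p|[[]//]].
  by rewrite hb.
have hE y : h y = y by case: y => [p|[[]//]].
congr existT; case: x w w0 x0 hs hm {g hK gK} => s m l [s' m' l'] /= -> -> hs hm.
congr Preweb; apply/ffunP => y; first by case: y.
by have /= := hm y; rewrite !hE.
Qed.

Lemma comp_flat c e d (g : preweb e d 'I_0) (f : preweb c e 'I_0) b b' :
  loops g = 0%N -> loops f = 0%N -> web_sim g (bw b) -> web_sim f (bw b') ->
  hcomp (reduct g) (reduct f) = reduct (stack g f).
Proof.
move=> g0 f0 gb fb'.
rewrite (reduct_flat _ gb) ?(reduct_flat _ fb'); try by case.
rewrite g0 f0 !expr0 !scale1r comp_basis /bw.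
by rewrite (flat_repr g0 gb) (flat_repr f0 fb').
Qed.

Section Flat.
Variables (c e d : word).

Definition flat_kept (u : hedge c d 'I_0) : hedge c e 'I_0 + hedge e d 'I_0 :=
  match u with
  | inl (inl i) => inl (bbot e _ i)
  | inl (inr j) => inr (btop e _ j)
  | inr (y, a) => inl (inr (y, a))
  end.

Definition unflat (u : hedge c d 'I_0) : hedge c d ('I_0 + 'I_0)%type :=
  match u with inl p => inl p | inr (y, a) => inr (inl y, a) end.
Definition flat (u : hedge c d ('I_0 + 'I_0)%type) : hedge c d 'I_0 :=
  match u with
  | inl p => inl p
  | inr (inl y, a) => inr (y, a)
  | inr (inr y, a) => inr (y, a)
  end.

Lemma unflatK : cancel unflat flat.
Proof. by case=> [p|[[]]]. Qed.
Lemma flatK : cancel flat unflat.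
Proof. by case=> [p|[[[]|[]]]]. Qed.
Lemma keptE (u : hedge c d ('I_0 + 'I_0)%type) : stack_kept e u = flat_kept (flat u).
Proof. by case: u => [[i|j]|[[[]|[]]]]. Qed.
End Flat.
Arguments flat {c d}.
Arguments unflat {c d}.
Arguments flatK {c d}.
Arguments unflatK {c d}.

Section FlatStack.
Variables (c e d : word) (g : preweb e d 'I_0) (f : preweb c e 'I_0).
Variables (w : preweb c d 'I_0).
Variable lab : hedge c e 'I_0 + hedge e d 'I_0 -> option (hedge c d 'I_0).

Local Notation sglue := (glue (stack_mate g f) (@stack_arc c e d 'I_0 'I_0)).

Hypothesis gK : involutive (mate g).
Hypothesis fK : involutive (mate f).

Lemma sglue_sym : connect_sym sglue.
Proof.
apply: sym_connect_sym => x y; rewrite /glue /=; congr (_ || _).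
  apply/eqP/eqP => <-; first by case: x => x /=; rewrite ?gK ?fK.
  by case: y => y /=; rewrite ?gK ?fK.
by case: x => [[[x|x]|x]|[[x|x]|x]]; case: y => [[[y|y]|y]|[[y|y]|y]] //=;
  rewrite eq_sym.
Qed.

Hypothesis wK : involutive (mate w).
Hypothesis w_neq : forall u, mate w u != u.
Hypothesis labG : forall x y, sglue x y ->
  lab y = lab x \/ lab y = omap (mate w) (lab x).
Hypothesis labK : forall u, lab (flat_kept e u) = Some u.
Hypothesis labC : forall t u, lab t = Some u ->
  connect sglue (flat_kept e u) t \/ connect sglue (flat_kept e (mate w u)) t.
Hypothesis keptN : forall u, connect sglue (flat_kept e u) (flat_kept e (mate w u)).

Lemma lab_connect x y : connect sglue x y ->
  lab y = lab x \/ lab y = omap (mate w) (lab x).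
Proof.
case/connectP=> p + ->; elim: p x => [|z p IH] x /=; first by left.
case/andP=> /labG xz /IH[->|->]; case: xz => ->; auto.
by left; case: (lab x) => //= u; rewrite wK.
Qed.

Lemma stack_flat : web_sim (stack g f) w.
Proof.
exists flat; split.
- by exists unflat; [apply: flatK | apply: unflatK].
- by [].
- by case=> [p|[[[]|[]]]].
- by case=> [[i|j]|[[[]|[]]]].
move=> u /=; rewrite ffunE; case: pickP => [u' /andP[ne C]|N].
  move: C; rewrite !keptE => /lab_connect; rewrite !labK => -[] [] // E.
  by rewrite (can_inj flatK E) eqxx in ne.
have := N (unflat (mate w (flat u))).
rewrite !keptE unflatK keptN andbT => /negbFE/eqP/(congr1 flat).
by rewrite unflatK => /eqP; rewrite (negbTE (w_neq _)).
Qed.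

Lemma stack_flat0 : (forall t, lab t) ->
  loops (stack g f) = (loops g + loops f)%N.
Proof.
move=> labS; rewrite /= (addnC (loops g)) -[RHS]addn0; congr (_ + _)%N.
rewrite /splice_loops /n_comp_mem; apply: eq_card0 => t.
rewrite !inE; apply/negP=> /andP[_ /andP[_ /forallP N]].
have := labS t; case E: (lab t) => [u|//] _.
have := N (unflat u); have := N (unflat (mate w u)); rewrite !keptE !unflatK.
by case: (labC E) => ->.
Qed.

Lemma stack_flat1 t0 :
  (forall t, lab t = None <-> connect sglue t0 t) ->
  (forall t, lab t = None -> exists s, @stack_arc c e d 'I_0 'I_0 t s) ->
  loops (stack g f) = (1 + (loops g + loops f))%N.
Proof.
move=> labN labA; rewrite /= addnC (addnC (loops g)); congr (_ + _)%N.
rewrite -(n_comp_connect sglue_sym t0); apply: eq_n_comp_r => t.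
rewrite !inE; apply/andP/idP => [[_ /forallP N]|/labN t0t].
  apply/labN; case E: (lab t) => [u|//].
  have := N (unflat u); have := N (unflat (mate w u)); rewrite !keptE !unflatK.
  by case: (labC E) => ->.
split; first by have [s ?] := labA t t0t; apply/existsP; exists s.
apply/forallP => u; apply/negP; rewrite keptE => /lab_connect.
by rewrite labK t0t => -[].
Qed.
End FlatStack.

Lemma stack_idl c e (w : preweb c e 'I_0) :
  involutive (mate w) -> (forall x, mate w x != x) ->
  web_sim (stack (idweb e) w) w /\ loops (stack (idweb e) w) = loops w.
Proof.
move=> wK w_neq.
have iK : involutive (mate (idweb e)) by case=> [[i|i]|[[]//]]; rewrite !ffunE.
pose lab (x : hedge c e 'I_0 + hedge e e 'I_0) : option (hedge c e 'I_0) :=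
  match x with
  | inl y => Some y
  | inr (inl (inl i)) => Some (btop c _ i)
  | inr (inl (inr i)) => Some (btop c _ i)
  | inr _ => None
  end.
set G := glue (stack_mate (idweb e) w) (@stack_arc c e e 'I_0 'I_0).
have labG x y : G x y -> lab y = lab x \/ lab y = omap (mate w) (lab x).
  case/orP=> [/eqP<-|].
    case: x => [x|[[i|i]|[[]//]]] /=; first by right.
      by left; rewrite ffunE.
    by left; rewrite ffunE.
  by case: x => [[[x|x]|[[]//]]|[[x|x]|[[]//]]]; case: y => [[[y|y]|[[]//]]|[[y|y]|[[]//]]] //= /eqP->; left.
have labK u : lab (flat_kept e u) = Some u by case: u => [[i|i]|[[]//]].
have down i : connect G (inr (btop e _ i)) (inr (bbot e _ i)).
  by apply: connect1; rewrite /G /glue /= ffunE eqxx.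
have down2 i : connect G (inr (btop e _ i)) (inl (btop c _ i)).
  apply: connect_trans (down i) (connect1 _).
  by rewrite /G /glue /= eqxx ?orbT.
have labC t u : lab t = Some u -> connect G (flat_kept e u) t.
  case: t => [t|[[i|i]|[[]//]]] //= [<-]; rewrite ?down ?connect0 //.
  by case: t => [[i|i]|[[]//]]; rewrite ?connect0 ?down2.
have keptN u : connect G (flat_kept e u) (flat_kept e (mate w u)).
  apply: connect_trans (labC (inl u) u erefl) _.
  have sym := sglue_sym iK wK; rewrite -/G in sym.
  rewrite sym; apply: connect_trans (labC (inl (mate w u)) _ erefl) _.
  by rewrite sym; apply: connect1; rewrite /G /glue /= eqxx.
split.
  exact: (stack_flat wK w_neq labG labK keptN).
have -> // := @stack_flat0 _ _ _ (idweb e) w w lab (fun t u H => or_introl (labC t u H)).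
by move=> [t|[[i|i]|[[]//]]].
Qed.

Lemma stack_idr c e (w : preweb c e 'I_0) :
  involutive (mate w) -> (forall x, mate w x != x) ->
  web_sim (stack w (idweb c)) w /\ loops (stack w (idweb c)) = loops w.
Proof.
move=> wK w_neq.
have iK : involutive (mate (idweb c)) by case=> [[i|i]|[[]//]]; rewrite !ffunE.
pose lab (x : hedge c c 'I_0 + hedge c e 'I_0) : option (hedge c e 'I_0) :=
  match x with
  | inr y => Some y
  | inl (inl (inl i)) => Some (bbot e _ i)
  | inl (inl (inr i)) => Some (bbot e _ i)
  | inl _ => None
  end.
set G := glue (stack_mate w (idweb c)) (@stack_arc c c e 'I_0 'I_0).
have labG x y : G x y -> lab y = lab x \/ lab y = omap (mate w) (lab x).
  case/orP=> [/eqP<-|].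
    case: x => [[[i|i]|[[]//]]|x] /=; last by right.
      by left; rewrite ffunE.
    by left; rewrite ffunE.
  by case: x => [[[x|x]|[[]//]]|[[x|x]|[[]//]]]; case: y => [[[y|y]|[[]//]]|[[y|y]|[[]//]]] //= /eqP->; left.
have labK u : lab (flat_kept c u) = Some u by case: u => [[i|i]|[[]//]].
have up i : connect G (inl (bbot c _ i)) (inl (btop c _ i)).
  by apply: connect1; rewrite /G /glue /= ffunE eqxx.
have up2 i : connect G (inl (bbot c _ i)) (inr (bbot e _ i)).
  apply: connect_trans (up i) (connect1 _).
  by rewrite /G /glue /= eqxx ?orbT.
have labC t u : lab t = Some u -> connect G (flat_kept c u) t.
  case: t => [[[i|i]|[[]//]]|t] //= [<-]; rewrite ?up ?connect0 //.
  by case: t => [[i|i]|[[]//]]; rewrite ?connect0 ?up2.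
have keptN u : connect G (flat_kept c u) (flat_kept c (mate w u)).
  apply: connect_trans (labC (inr u) u erefl) _.
  have sym := sglue_sym wK iK; rewrite -/G in sym.
  rewrite sym; apply: connect_trans (labC (inr (mate w u)) _ erefl) _.
  by rewrite sym; apply: connect1; rewrite /G /glue /= eqxx.
split.
  exact: (stack_flat wK w_neq labG labK keptN).
have -> := @stack_flat0 _ _ _ w (idweb c) w lab (fun t u H => or_introl (labC t u H)).
  by rewrite addn0.
by move=> [[[i|i]|[[]//]]|t].
Qed.

(* The web which is a cap below a cup. *)
Definition capcup : preweb pm pm 'I_0 := Preweb [ffun => true]
  [ffun x => match x with
             | inl (inl i) => inl (inl (rev_ord i))
             | inl (inr i) => inl (inr (rev_ord i))
             | inr _ => x
             end] 0.

Lemma rev_ord2_neq (i : 'I_2) : rev_ord i != i.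
Proof. by case: i => [[|[|[]]]]. Qed.

Lemma capcup_mateK : involutive (mate capcup).
Proof. by case=> [[i|i]|[[]//]]; rewrite !ffunE rev_ordK. Qed.
Lemma cup_mateK : involutive (mate cupweb).
Proof. by case=> [[[]//|i]|[[]//]]; rewrite !ffunE rev_ordK. Qed.
Lemma cap_mateK : involutive (mate capweb).
Proof. by case=> [[i|[]//]|[[]//]]; rewrite !ffunE rev_ordK. Qed.

Lemma capcup_mate_neq x : mate capcup x != x.
Proof.
case: x => [[i|i]|[[]//]]; rewrite ffunE.
  by have := rev_ord2_neq i; apply: contraNN => /eqP[->].
by have := rev_ord2_neq i; apply: contraNN => /eqP[->].
Qed.

Lemma stack_cup_cap : web_sim (stack cupweb capweb) capcup /\
  loops (stack cupweb capweb) = 0%N.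
Proof.
pose lab (x : hedge pm [::] 'I_0 + hedge [::] pm 'I_0) : option (hedge pm pm 'I_0) :=
  match x with
  | inl (inl (inl i)) => Some (inl (inl i))
  | inr (inl (inr i)) => Some (inl (inr i))
  | _ => None
  end.
set G := glue (stack_mate cupweb capweb) (@stack_arc pm [::] pm 'I_0 'I_0).
have labG x y : G x y -> lab y = lab x \/ lab y = omap (mate capcup) (lab x).
  case/orP=> [/eqP<-|].
    by case: x => [[[i|[]//]|[[]//]]|[[[]//|i]|[[]//]]] /=; right; rewrite !ffunE.
  by case: x => [[[x|[]//]|[[]//]]|[[[]//|x]|[[]//]]].
have labK u : lab (flat_kept [::] u) = Some u by case: u => [[i|i]|[[]//]].
have labC t u : lab t = Some u -> connect G (flat_kept [::] u) t.
  by case: t => [[[i|[]//]|[[]//]]|[[[]//|i]|[[]//]]] //= [<-].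
have keptN u : connect G (flat_kept [::] u) (flat_kept [::] (mate capcup u)).
  by case: u => [[i|i]|[[]//]]; rewrite ffunE; apply: connect1; rewrite /G /glue /= ffunE eqxx.
split; first exact: (stack_flat capcup_mateK capcup_mate_neq labG labK keptN).
have -> // := @stack_flat0 _ _ _ cupweb capweb capcup lab
  (fun t u H => or_introl (labC t u H)).
by move=> [[[i|[]//]|[[]//]]|[[[]//|i]|[[]//]]].
Qed.

Lemma stack_capcup2 : web_sim (stack capcup capcup) capcup /\
  loops (stack capcup capcup) = 1%N.
Proof.
pose lab (x : hedge pm pm 'I_0 + hedge pm pm 'I_0) : option (hedge pm pm 'I_0) :=
  match x with
  | inl (inl (inl i)) => Some (inl (inl i))
  | inr (inl (inr i)) => Some (inl (inr i))
  | _ => None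
  end.
set G := glue (stack_mate capcup capcup) (@stack_arc pm pm pm 'I_0 'I_0).
have labG x y : G x y -> lab y = lab x \/ lab y = omap (mate capcup) (lab x).
  case/orP=> [/eqP<-|].
    by case: x => [[[i|i]|[[]//]]|[[i|i]|[[]//]]] /=; rewrite !ffunE; auto.
  by case: x => [[[x|x]|[[]//]]|[[x|x]|[[]//]]]; case: y => [[[y|y]|[[]//]]|[[y|y]|[[]//]]] //= _; left.
have labK u : lab (flat_kept pm u) = Some u by case: u => [[i|i]|[[]//]].
have labC t u : lab t = Some u -> connect G (flat_kept pm u) t.
  by case: t => [[[i|i]|[[]//]]|[[i|i]|[[]//]]] //= [<-].
have keptN u : connect G (flat_kept pm u) (flat_kept pm (mate capcup u)).
  by case: u => [[i|i]|[[]//]]; rewrite ffunE; apply: connect1; rewrite /G /glue /= ffunE eqxx.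
split; first exact: (stack_flat capcup_mateK capcup_mate_neq labG labK keptN).
rewrite (@stack_flat1 _ _ _ _ _ capcup lab capcup_mateK capcup_mateK _ _ labK _
  (inl (inl (inr ord0)))) //.
- exact: capcup_mateK.
- by move=> t u /labC; left.
- move=> t; split=> [|/(lab_connect capcup_mateK labG)[]->//].
  have topN (i : 'I_2) : connect G (inl (inl (inr ord0))) (inl (inl (inr i))).
    have [->|] := eqVneq i ord0; first exact: connect0.
    move=> i0; apply: connect1; rewrite /G /glue /= ffunE; apply/orP; left.
    by apply/eqP; congr (inl (inl (inr _))); apply/val_inj; case: i i0 => [[|[|[]]]].
  case: t => [[[i|i]|[[]//]]|[[i|i]|[[]//]]] //= _.
  by apply: connect_trans (topN i) (connect1 _); rewrite /G /glue /= eqxx ?orbT.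
move=> [[[i|i]|[[]//]]|[[i|i]|[[]//]]] //= _.
  by exists (inr (inl (inl i))) => /=.
by exists (inl (inl (inr i))) => /=.
Qed.

Lemma n_compE (T : finType) (r : rel T) (rep : T -> T) : connect_sym r ->
  (forall x y, r x y -> rep x = rep y) -> (forall x, connect r x (rep x)) ->
  n_comp r predT = #|[set rep x | x in T]|.
Proof.
move=> sym repr repC.
have repE x y : connect r x y -> rep x = rep y.
  by case/connectP=> p + ->; elim: p x => //= z p IH x /andP[/repr-> /IH].
have repR x : rep (fingraph.root r x) = rep x by rewrite -(repE _ _ (connect_root r x)).
have -> : [set rep x | x in T] = rep @: [set x | roots r x].
  apply/setP=> z; apply/imsetP/imsetP => [[x _ ->]|[x _ ->]].
    by exists (fingraph.root r x); rewrite ?repR // inE roots_root.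
  by exists x.
rewrite card_in_imset ?cardsE.
  by rewrite /n_comp_mem; apply: eq_card => x; rewrite !inE andbT.
move=> x y; rewrite !inE => /eqP rx /eqP ry E.
rewrite -rx -ry; apply/(fingraph.rootP sym).
have := repC x; rewrite E => xr.
by apply: connect_trans xr _; rewrite sym.
Qed.

Section IdPm.
Let T := hedge pm pm 'I_0.
Let B0 : T := inl (inl (Ordinal (isT : 0 < 2)%N)).
Let B1 : T := inl (inl (Ordinal (isT : 1 < 2)%N)).
Let T0 : T := inl (inr (Ordinal (isT : 0 < 2)%N)).
Let T1 : T := inl (inr (Ordinal (isT : 1 < 2)%N)).

Let TP (x : T) : [\/ x = B0, x = B1, x = T0 | x = T1].
Proof.
case: x => [[[[|[|//]] i]|[[|[|//]] i]]|[[]//]].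
- by apply: Or41; congr (inl (inl _)); apply: val_inj.
- by apply: Or42; congr (inl (inl _)); apply: val_inj.
- by apply: Or43; congr (inl (inr _)); apply: val_inj.
- by apply: Or44; congr (inl (inr _)); apply: val_inj.
Qed.

Let boundaryE : boundary pm pm =
  [:: inr (Ordinal (isT : 0 < 2)%N); inr (Ordinal (isT : 1 < 2)%N);
      inl (Ordinal (isT : 1 < 2)%N); inl (Ordinal (isT : 0 < 2)%N)].
Proof.
have E : enum 'I_2 = [:: Ordinal (isT : 0 < 2)%N; Ordinal (isT : 1 < 2)%N].
  by apply: (inj_map val_inj); rewrite val_enum_ord.
by rewrite /boundary /= E.
Qed.

Let tT0 : turn T0 = T1. Proof. by rewrite /= boundaryE. Qed.
Let tT1 : turn T1 = B1. Proof. by rewrite /= boundaryE. Qed.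
Let tB1 : turn B1 = B0. Proof. by rewrite /= boundaryE. Qed.
Let tB0 : turn B0 = T0. Proof. by rewrite /= boundaryE. Qed.
Let tE := (tT0, tT1, tB0, tB1).
Let m := mate (idweb pm).
Let mT0 : m T0 = B0. Proof. by rewrite /m ffunE. Qed.
Let mT1 : m T1 = B1. Proof. by rewrite /m ffunE. Qed.
Let mB1 : m B1 = T1. Proof. by rewrite /m ffunE. Qed.
Let mB0 : m B0 = T0. Proof. by rewrite /m ffunE. Qed.
Let mE := (mT0, mT1, mB0, mB1).

Let mK : involutive m.
Proof. by move=> x; case: (TP x) => ->; rewrite !mE. Qed.

Let turn_inj : injective (@turn pm pm 'I_0).
Proof.
by move=> x y; case: (TP x) => ->; case: (TP y) => ->; rewrite !tE.
Qed.

Let fcE (f : T -> T) (rep : T -> T) : injective f ->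
  (forall x, rep (f x) = rep x) -> (forall x, exists n, iter n f x = rep x) ->
  fcard f predT = #|[set rep x | x in T]|.
Proof.
move=> f_inj repf itf; apply: n_compE => [|x y /eqP<-|x]; first exact: fconnect_sym.
  by rewrite repf.
by have [n <-] := itf x; apply: fconnect_iter.
Qed.

Lemma idpm_basis : is_basis (idweb pm).
Proof.
split=> //; last first.
  by move=> x /(_ x (connect0 _ _))[[[]//]].
split; first exact: mK.
  by case=> [[i|i]|[[]//]]; rewrite ffunE /= ?negbK.
rewrite /planar -/T -/m.
have cT : #|T| = 4%N by rewrite !card_sum card_prod !card_ord.
set f := face_step _.
have fE : (f T0 = T0) * (f T1 = B0) * (f B0 = T1) * (f B1 = B1).
  by rewrite /f /face_step -/m !mE !tE.
have -> : fcard (@turn pm pm 'I_0) predT = 1%N.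
  rewrite (fcE (rep := fun=> T0)) //.
    rewrite (_ : [set _ | x in T] = [set T0]) ?cards1 //.
    by apply/setP=> y; rewrite inE; apply/imsetP/eqP => [[]|->] //; exists T0.
  move=> x; case: (TP x) => ->; [exists 1%N | exists 2%N | exists 0%N | exists 3%N];
    rewrite /iter ?tE //.
have -> : fcard m predT = 2%N.
  pose rep x := if (x == B0) || (x == T0) then T0 else T1.
  rewrite (fcE (rep := rep)).
  - rewrite (_ : [set _ | x in T] = [set T0; T1]) ?cards2 //.
    apply/setP=> y; rewrite !inE; apply/imsetP/orP.
      by case=> x _ ->; rewrite /rep; case: ifP => _; [left|right].
    by case=> /eqP->; [exists T0 | exists T1].
  - exact: inv_inj mK.
  - by move=> x; case: (TP x) => ->; rewrite !mE.
  move=> x; case: (TP x) => ->; [exists 1%N | exists 1%N | exists 0%N | exists 0%N] => //=;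
    by rewrite mE.
have -> : fcard f predT = 3%N.
  pose rep x := if x == B0 then T1 else x.
  rewrite (fcE (rep := rep)).
  - rewrite (_ : [set _ | x in T] = T0 |: [set T1; B1]); first by rewrite cardsU1 cards2 !inE.
    apply/setP=> y; rewrite !inE; apply/imsetP/idP.
      by case=> x _ ->; case: (TP x) => ->; rewrite /rep.
    by case/or3P=> /eqP->; [exists T0 | exists T1 | exists B1].
  - by apply: inj_comp; [apply: turn_inj | apply: inv_inj mK].
  - by move=> x; case: (TP x) => ->; rewrite fE.
  move=> x; case: (TP x) => ->; [exists 1%N | exists 0%N | exists 0%N | exists 0%N] => //=;
    by rewrite fE.
rewrite cT; set r := [rel x y | _].
have rI x : connect r x (turn x) by apply: connect1; rewrite /r /= eqxx.
have r1 : connect r T0 T1 by rewrite -tT0.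
have r2 : connect r T0 B1 by rewrite -tT1; apply: connect_trans r1 (rI _).
have r3 : connect r T0 B0 by rewrite -tB1; apply: connect_trans r2 (rI _).
have r4 : connect r B0 T0 by rewrite -[T0 in X in is_true X]tB0.
have r5 : connect r B1 T0 by apply: connect_trans (rI _) _; rewrite tB1.
have r6 : connect r T1 T0 by apply: connect_trans (rI _) _; rewrite tT1.
have rT x y : connect r x y.
  apply: (@connect_trans _ _ T0); first by case: (TP x) => ->.
  by case: (TP y) => ->.
rewrite (n_compE (rep := fun=> T0)) => [||//|x]; last exact: rT.
  rewrite (_ : [set _ | x in T] = [set T0]) ?cards1 //.
  by apply/setP=> y; rewrite inE; apply/imsetP/eqP => [[]|->] //; exists T0.
by move=> x y; rewrite !rT.
Qed.
End IdPm.

Lemma idweb_mateK e : involutive (mate (idweb e)).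
Proof. by case=> [[i|i]|[[]//]]; rewrite !ffunE. Qed.

Lemma idweb_mate_neq e x : mate (idweb e) x != x.
Proof. by case: x => [[i|i]|[[]//]]; rewrite !ffunE. Qed.

Lemma no_vertex : ('I_0 : finType) -> False.
Proof. by case. Qed.

Lemma no_vertex2 : ('I_0 + 'I_0)%type -> False.
Proof. by case=> [[]|[]]. Qed.

Lemma basis_flat e d (w : preweb e d 'I_0) : is_basis w ->
  exists b : basis_web e d, web_sim w (bw b).
Proof.
move=> /asboolP B; exists (@exist (numweb e d)
  (fun u => `[< is_basis (tagged u) >]) (existT _ 0%N w) B).
exact: web_sim_refl.
Qed.

Lemma flat_cases e d (w : preweb e d 'I_0) :
  reduct w = 0 \/ exists b : basis_web e d, web_sim w (bw b).
Proof.
have [|N] := pselect (exists b : basis_web e d, web_sim w (bw b)); first by right.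
by left; apply: (reduct_flat0 no_vertex) => b S; apply: N; exists b.
Qed.

Lemma comp_flatE c e d (g : preweb e d 'I_0) (f : preweb c e 'I_0)
    (w : preweb c d 'I_0) b b' n :
  loops g = 0%N -> loops f = 0%N -> loops w = 0%N ->
  web_sim g (bw b) -> web_sim f (bw b') ->
  web_sim (stack g f) w -> loops (stack g f) = n ->
  hcomp (reduct g) (reduct f) = qint 3 ^+ n *: reduct w.
Proof.
move=> g0 f0 w0 gb fb S L; rewrite (comp_flat g0 f0 gb fb).
by apply: (reduct_sim no_vertex2 no_vertex S); rewrite w0 addn0.
Qed.

Lemma idhom_idem e : hcomp (idhom e) (idhom e) = idhom e.
Proof.
rewrite /idhom; have [->|[b S]] := flat_cases (idweb e); first by rewrite comp0l.
have [S1 L1] := stack_idl (@idweb_mateK e) (@idweb_mate_neq e).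
by rewrite (comp_flatE (w := idweb e) (n := 0) _ _ _ S S S1 L1) // expr0 scale1r.
Qed.

Lemma cupcap_comp : hcomp cup cap = 0 \/ hcomp cup cap = reduct capcup.
Proof.
rewrite /cup /cap; have [->|[b S]] := flat_cases cupweb.
  by left; rewrite comp0l.
have [->|[b' S']] := flat_cases capweb; first by left; rewrite comp0r.
have [S1 L1] := stack_cup_cap.
by right; rewrite (comp_flatE (w := capcup) (n := 0) _ _ _ S S' S1 L1) // expr0 scale1r.
Qed.

Lemma clasp_idem : qint 3 != 0 -> hcomp clasp clasp = clasp.
Proof.
move=> q3; rewrite /clasp; set u := hcomp cup cap; set I := idhom pm.
have [b0 S0] : exists b : basis_web pm pm, web_sim (idweb pm) (bw b).
  exact/basis_flat/idpm_basis.
have [[Iu uI] uu] : (hcomp I u = u /\ hcomp u I = u) /\ hcomp u u = qint 3 *: u.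
  rewrite /u; case: cupcap_comp => ->.
    by rewrite comp0r !comp0l scaler0.
  have [->|[b S]] := flat_cases capcup; first by rewrite comp0r !comp0l scaler0.
  have [S1 L1] := stack_idl capcup_mateK capcup_mate_neq.
  have [S2 L2] := stack_idr capcup_mateK capcup_mate_neq.
  have [S3 L3] := stack_capcup2.
  rewrite /I /idhom (comp_flatE (w := capcup) (n := 0) _ _ _ S0 S S1 L1) //.
  rewrite (comp_flatE (w := capcup) (n := 0) _ _ _ S S0 S2 L2) //.
  rewrite (comp_flatE (w := capcup) (n := 1) _ _ _ S S S3 L3) //.
  by rewrite expr0 expr1 scale1r.
set a := - (qint 3)^-1.
rewrite (_ : I - _ = a *: u + I); last by rewrite /a scaleNr addrC.
have lin (V : lmodType K) (x y : V) :
    a *: (a *: (qint 3 *: x) + x) + (a *: x + y) = a *: x + y.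
  rewrite (scalerA a (qint 3)) (_ : a * _ = -1); last first.
    by rewrite /a mulNr mulVf.
  by rewrite scaleN1r addNr scaler0 add0r.
by rewrite compPr !compPl /I idhom_idem -/I Iu uI uu; apply: lin.
Qed.

Record kobj := KObj {
  kword : word;
  kidem : hom kword kword;
  kidemP : hcomp kidem kidem = kidem }.

Definition id_obj (e : word) : kobj := KObj (idhom_idem e).
Definition clasp_obj (q3 : qint 3 != 0) : kobj := KObj (clasp_idem q3).

(* Objects of the Karoubi envelope: formal finite direct sums, with matrices of
   morphisms between them. *)
Definition kar := seq kobj.
Definition summand (A : kar) (i : 'I_(size A)) : kobj := tnth (in_tuple A) i.

Definition kmatrix (A B : kar) := forall (i : 'I_(size B)) (j : 'I_(size A)),
  hom (kword (summand j)) (kword (summand i)).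

Definition is_kmor A B (f : kmatrix A B) : Prop := forall i j,
  hcomp (hcomp (kidem (summand i)) (f i j)) (kidem (summand j)) = f i j.

Definition kcomp A B C (g : kmatrix B C) (f : kmatrix A B) : kmatrix A C :=
  fun i k => \sum_(j < size B) hcomp (g i j) (f j k).

Definition kid A : kmatrix A A := fun i j =>
  match @eqP _ j i with
  | ReflectT E =>
      ecast k (hom (kword (summand j)) (kword (summand k))) E
        (kidem (summand j))
  | ReflectF _ => 0
  end.

Definition kiso (A B : kar) : Prop :=
  exists (f : kmatrix A B) (g : kmatrix B A),
    [/\ is_kmor f, is_kmor g,
        forall i j, kcomp g f i j = kid i j
      & forall i j, kcomp f g i j = kid i j].

(* [ktensor1 a b c] holds for the single object c = a (x) b; a relation, because
   the idempotency of a tensor product is only available as a proof. *)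
Inductive ktensor1 (a b : kobj) : kobj -> Prop :=
  KTensor1 (h : hcomp (tensor (kidem a) (kidem b)) (tensor (kidem a) (kidem b))
                = tensor (kidem a) (kidem b)) : ktensor1 a b (KObj h).

Definition ktensor (A B C : kar) : Prop :=
  List.Forall2 (fun ab c => ktensor1 ab.1 ab.2 c)
    [seq (a, b) | a <- A, b <- B] C.

(* K_0 is the ring presented by the symbols <A> and the defining relations. *)
Inductive kterm :=
| KZero | KOne | KGen of kar
| KOpp of kterm | KAdd of kterm & kterm | KMul of kterm & kterm.

Inductive keq : kterm -> kterm -> Prop :=
| keq_refl a : keq a a
| keq_sym a b : keq a b -> keq b a
| keq_trans a b c : keq a b -> keq b c -> keq a c
| keq_opp a a' : keq a a' -> keq (KOpp a) (KOpp a')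
| keq_add a a' b b' : keq a a' -> keq b b' -> keq (KAdd a b) (KAdd a' b')
| keq_mul a a' b b' : keq a a' -> keq b b' -> keq (KMul a b) (KMul a' b')
| keq_addA a b c : keq (KAdd a (KAdd b c)) (KAdd (KAdd a b) c)
| keq_addC a b : keq (KAdd a b) (KAdd b a)
| keq_add0 a : keq (KAdd KZero a) a
| keq_addN a : keq (KAdd (KOpp a) a) KZero
| keq_mulA a b c : keq (KMul a (KMul b c)) (KMul (KMul a b) c)
| keq_mul1l a : keq (KMul KOne a) a
| keq_mul1r a : keq (KMul a KOne) a
| keq_mulDl a b c : keq (KMul (KAdd a b) c) (KAdd (KMul a c) (KMul b c))
| keq_mulDr a b c : keq (KMul a (KAdd b c)) (KAdd (KMul a b) (KMul a c))
| keq_iso A B : kiso A B -> keq (KGen A) (KGen B)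
| keq_sum A B : keq (KGen (A ++ B)) (KAdd (KGen A) (KGen B))
| keq_tensor A B C : ktensor A B C -> keq (KGen C) (KMul (KGen A) (KGen B))
| keq_unit : keq (KGen [:: id_obj [::]]) KOne.

Definition keqb : rel kterm := fun a b => `[< keq a b >].

Lemma keqb_refl : reflexive keqb.
Proof. by move=> a; apply/asboolP/keq_refl. Qed.
Lemma keqb_sym : symmetric keqb.
Proof. by move=> a b; apply/asboolP/asboolP; apply: keq_sym. Qed.
Lemma keqb_trans : transitive keqb.
Proof. by move=> b a c /asboolP ab /asboolP bc; apply/asboolP/(keq_trans ab bc). Qed.

HB.instance Definition _ := gen_eqMixin kterm.
HB.instance Definition _ := gen_choiceMixin kterm.

Canonical keqb_equiv := EquivRel keqb keqb_refl keqb_sym keqb_trans.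
Definition K0 := {eq_quot keqb}.
HB.instance Definition _ := Choice.on K0.
HB.instance Definition _ := EqQuotient.on K0.

Lemma keqP (a b : kterm) : keq a b -> \pi_K0 a = \pi_K0 b.
Proof. by move=> ab; apply/eqmodP/asboolP. Qed.

Lemma keq_repr (a : kterm) : keq (repr (\pi_K0 a)) a.
Proof.
suff: keqb (repr (\pi_K0 a)) a by move/asboolP.
by apply/eqmodP; rewrite reprK.
Qed.

Definition K0_opp (x : K0) : K0 := \pi_K0 (KOpp (repr x)).
Definition K0_add (x y : K0) : K0 := \pi_K0 (KAdd (repr x) (repr y)).
Definition K0_mul (x y : K0) : K0 := \pi_K0 (KMul (repr x) (repr y)).

Lemma K0_oppE a : K0_opp (\pi_K0 a) = \pi_K0 (KOpp a).
Proof. exact/keqP/keq_opp/keq_repr. Qed.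
Lemma K0_addE a b : K0_add (\pi_K0 a) (\pi_K0 b) = \pi_K0 (KAdd a b).
Proof. by apply/keqP/keq_add; apply: keq_repr. Qed.
Lemma K0_mulE a b : K0_mul (\pi_K0 a) (\pi_K0 b) = \pi_K0 (KMul a b).
Proof. by apply/keqP/keq_mul; apply: keq_repr. Qed.

Lemma K0_addA : associative K0_add.
Proof.
elim/quotW=> x; elim/quotW=> y; elim/quotW=> z.
rewrite (K0_addE x y) (K0_addE y z) (K0_addE x) (K0_addE _ z).
exact/keqP/keq_addA.
Qed.
Lemma K0_addC : commutative K0_add.
Proof. by move=> x y; apply/keqP/keq_addC. Qed.
Lemma K0_add0 : left_id (\pi_K0 KZero) K0_add.
Proof. by elim/quotW=> x; rewrite K0_addE; apply/keqP/keq_add0. Qed.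
Lemma K0_addN : left_inverse (\pi_K0 KZero) K0_opp K0_add.
Proof.
by elim/quotW=> x; rewrite (K0_oppE x) K0_addE; apply/keqP/keq_addN.
Qed.
Lemma K0_mulA : associative K0_mul.
Proof.
elim/quotW=> x; elim/quotW=> y; elim/quotW=> z.
rewrite (K0_mulE x y) (K0_mulE y z) (K0_mulE x) (K0_mulE _ z).
exact/keqP/keq_mulA.
Qed.
Lemma K0_mul1l : left_id (\pi_K0 KOne) K0_mul.
Proof. by elim/quotW=> x; rewrite K0_mulE; apply/keqP/keq_mul1l. Qed.
Lemma K0_mul1r : right_id (\pi_K0 KOne) K0_mul.
Proof. by elim/quotW=> x; rewrite K0_mulE; apply/keqP/keq_mul1r. Qed.
Lemma K0_mulDl : left_distributive K0_mul K0_add.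
Proof.
elim/quotW=> x; elim/quotW=> y; elim/quotW=> z.
rewrite (K0_addE x y) (K0_mulE x z) (K0_mulE y z) (K0_mulE _ z) K0_addE.
exact/keqP/keq_mulDl.
Qed.
Lemma K0_mulDr : right_distributive K0_mul K0_add.
Proof.
elim/quotW=> x; elim/quotW=> y; elim/quotW=> z.
rewrite (K0_addE y z) (K0_mulE x y) (K0_mulE x z) (K0_mulE x) K0_addE.
exact/keqP/keq_mulDr.
Qed.

HB.instance Definition _ :=
  GRing.isZmodule.Build K0 K0_addA K0_addC K0_add0 K0_addN.
HB.instance Definition _ :=
  GRing.Zmodule_isPzRing.Build K0 K0_mulA K0_mul1l K0_mul1r K0_mulDl K0_mulDr.

Definition kclass (A : kar) : K0 := \pi_K0 (KGen A).
End Spider.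

(* The field C(q^(1/6)), with q^(1/6) the indeterminate. *)
Definition Cq16 (R : realType) : fieldType := {fraction {poly R[i]}}.
Definition q16 (R : realType) : Cq16 R := tofrac ('X : {poly R[i]}).

Lemma q16_neq (R : realType) n : q16 R ^+ n.+1 - q16 R ^- n.+1 != 0.
Proof.
rewrite subr_eq0; apply/negP=> /eqP E.
have q0 : q16 R ^+ n.+1 != 0 by rewrite expf_neq0 // tofrac_eq0 polyX_eq0.
have : q16 R ^+ (n.+1 + n.+1) == 1 by rewrite exprD {1}E mulVf.
rewrite -tofracXn -tofrac1 tofrac_eq => /eqP/(congr1 (size : {poly R[i]} -> nat)).
by rewrite size_polyXn size_poly1.
Qed.

Lemma qint3_neq0 (R : realType) : qint (q16 R) 3 != 0.
Proof. by rewrite mulf_neq0 ?invr_neq0 ?q16_neq. Qed.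

(* Main.v *)
Require Import Defs.
From mathcomp Require Import all_boot all_order all_algebra.
From mathcomp Require Import boolp classical_sets reals.
From mathcomp.multinomials Require Import monalg.
From mathcomp Require Import zify.

(* The clasp p = 1 - u / [3] with u = cup . cap splits off a copy of the unit
   object from +-: the maps (p, cap / [3]) and (p, cup) are mutually inverse
   between (+-, 1) and (+-, p) + (empty, 1), because cap . cup = [3], so that
   p . cup = 0 and cap . p = 0.  Since (+, 1) (x) (-, 1) = (+-, 1), this reads
   XY = P + 1.  Only webs without internal vertices occur.  A nonempty such web is
   planar as soon as it has one more face than edges, the turn around the
   boundary being a single orbit; planarity matters because [reduct] sends a web
   that is not planar to the junk value 0. *)

Set Implicit Arguments.
Unset Strict Implicit.
Unset Printing Implicit Defensive.

Import GRing.Theory.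
Local Open Scope ring_scope.

(** * Planarity of webs without internal vertices *)

Lemma n_comp_transitive (U : finType) (r : rel U) (x0 : U) :
  (forall x y, connect r x y) -> n_comp r predT = 1%N.
Proof.
move=> rT; rewrite (n_compE (rep := fun=> x0)) //; last by move=> x y; rewrite !rT.
apply/eqP/cards1P; exists x0; apply/setP=> y; rewrite inE.
by apply/imsetP/eqP => [[]|->] //; exists x0.
Qed.

Section FlatPlanar.
Variables (e d : word) (w : preweb e d 'I_0).

Local Notation T := (hedge e d 'I_0).

Hypothesis mK : involutive (mate w).
Hypothesis m_neq : forall x, mate w x != x.

Lemma boundary_uniq : uniq (boundary e d).
Proof.
rewrite /boundary cat_uniq rev_uniq.
rewrite (map_inj_uniq (f := inr)) ?(map_inj_uniq (f := inl)); try by move=> i j [].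
rewrite !enum_uniq /= andbT.
by apply/hasPn => x; rewrite mem_rev => /mapP[i _ ->]; apply/mapP => -[].
Qed.

Lemma mem_boundary x : x \in boundary e d.
Proof.
rewrite /boundary mem_cat mem_rev; case: x => i; apply/orP; [right|left];
  by rewrite map_f ?mem_enum.
Qed.

Lemma turn_flat_inj : injective (@turn e d 'I_0).
Proof.
move=> [p|[[]//]] [q|[[]//]] [/(congr1 (prev (boundary e d)))].
by rewrite !prev_next ?boundary_uniq // => ->.
Qed.

(** Every half-edge is a boundary point here, and [turn] is the successor along the cycle
    [boundary], which visits each of them once. *)
Lemma fconnect_turn (x y : T) : fconnect (@turn e d 'I_0) x y.
Proof.
case: x y => [p|[[]//]] [q|[[]//]].
have: fconnect (next (boundary e d)) p q.
  rewrite (fconnect_cycle (cycle_next boundary_uniq)) ?mem_boundary //.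
case/connectP=> s + ->; elim: s p => [|r s IH] p /=; first by rewrite connect0.
case/andP=> /eqP<- /IH; apply: connect_trans; apply: connect1.
by rewrite /= eqxx.
Qed.

Lemma fcard_mate : (fcard (mate w) predT * 2 = #|T|)%N.
Proof.
rewrite -(@fcard_order_set _ _ (inv_inj mK) 2 predT) //.
apply/fintype.subsetP => x _; rewrite unfold_in; apply/eqP.
rewrite (@order_cycle _ (mate w) [:: x; mate w x]) //=.
- by rewrite /= mK !eqxx.
- by rewrite inE eq_sym m_neq.
- by rewrite !inE eqxx.
Qed.

(** Euler's relation with one vertex (the point at infinity), [#|T|] / 2 edges and one component; it
    is doubled to avoid halving. The half-edge [x0] ensures that the vertex at infinity is there. *)
Lemma planar_flat (x0 : T) :
  (fcard (face_step w) predT).*2 = #|T|.+2 -> planar w.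
Proof.
move=> F; rewrite /planar (n_comp_transitive x0 fconnect_turn).
rewrite (n_comp_transitive (r := [rel x y | _ || _]) x0); last first.
  move=> x y; apply: connect_sub (fconnect_turn x y) => {}x {}y E.
  by apply: connect1; apply/orP; left.
have := fcard_mate; set a := fcard _ _; set b := fcard _ _ in F *.
move=> A; apply: double_inj; rewrite !doubleD F -(muln2 a) A.
by rewrite -!addnn !addnA; lia.
Qed.

(** Both [turn] and [mate w] must be the swap, so [face_step w] is the identity and the single edge
    has two faces. *)
Lemma planar_flat2 : #|T| = 2%N -> planar w.
Proof.
move=> T2; have [x0 _] : exists x : T, x \in T by apply/card_gt0P; rewrite T2.
apply: (planar_flat x0); rewrite T2.
have two (x y z : T) : x != y -> z != y -> x = z.
  move=> xy zy; apply/eqP; apply: contraTT isT => xz.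
  have: (#|[:: x; y; z]| <= 2)%N by rewrite -T2 max_card.
  by rewrite (card_uniqP _) //= !inE negb_or xy xz eq_sym zy.
(* A fixed point of the transitive [turn] would be the only half-edge, but [mate w x] is another
   one. *)
have turn_neq x : turn x != x :> T.
  apply: contraTneq (m_neq x) => tx.
  by have /iter_findex := fconnect_turn x (mate w x); rewrite iter_fix // => <-;
    rewrite eqxx.
have fE x : face_step w x = x.
  by rewrite /face_step; apply: (two _ (mate w x)); rewrite ?turn_neq // eq_sym.
rewrite (n_compE (rep := id)) //.
- by rewrite card_imset // T2.
- by apply: fconnect_sym => x y; rewrite !fE.
- by move=> x y /=; rewrite fE => /eqP.
Qed.

(** An internal face would consist of half-edges at internal vertices, so the bound on the number of
    sides is vacuous. *)
Lemma is_basis_flat : planar w ->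
  (forall x, is_tail w (mate w x) = ~~ is_tail w x) -> loops w = 0%N -> is_basis w.
Proof. by move=> P t l; split=> // x /(_ x (connect0 _ _))[[[]//]]. Qed.

End FlatPlanar.

(** * Identities, cup, cap and [capcup] are basis webs *)

Lemma idweb_is_tail e x : is_tail (idweb e) (mate (idweb e) x) = ~~ is_tail (idweb e) x.
Proof. by case: x => [[i|i]|[[]//]]; rewrite ffunE //= negbK. Qed.

Lemma idweb1_basis s : is_basis (idweb [:: s]).
Proof.
apply: is_basis_flat; [exact: idweb_mateK| |exact: idweb_is_tail|by []].
apply: planar_flat2; [exact: idweb_mateK|exact: idweb_mate_neq|].
by rewrite !card_sum card_prod !card_ord.
Qed.

Lemma hedge_nil (x : hedge [::] [::] 'I_0) : False.
Proof. by case: x => [[[]|[]]|[[]]]. Qed.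

(** The empty web offers no half-edge to [planar_flat]; instead all counts in Euler's relation
    vanish. *)
Lemma idweb0_basis : is_basis (idweb [::]).
Proof.
apply: is_basis_flat; [exact: idweb_mateK| |exact: idweb_is_tail|by []].
have T0 : #|hedge [::] [::] 'I_0| = 0%N by rewrite !card_sum card_prod !card_ord.
have n0 (P : pred (hedge [::] [::] 'I_0)) : #|P| = 0%N.
  by apply: eq_card0 => x; case: (hedge_nil x).
by rewrite /planar T0 /n_comp_mem !n0.
Qed.

Lemma cup_mate_neq x : mate cupweb x != x.
Proof.
case: x => [[[]//|i]|[[]//]]; rewrite ffunE.
by have := rev_ord2_neq i; apply: contraNN => /eqP[->].
Qed.

Lemma cap_mate_neq x : mate capweb x != x.
Proof.
case: x => [[i|[]//]|[[]//]]; rewrite ffunE.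
by have := rev_ord2_neq i; apply: contraNN => /eqP[->].
Qed.

Lemma nth_pm_rev (i : 'I_2) : nth true pm (rev_ord i) = ~~ nth true pm i.
Proof. by case: i => [[|[|[]]]]. Qed.

Lemma cup_basis : is_basis cupweb.
Proof.
apply: is_basis_flat; [exact: cup_mateK| | |by []]; last first.
  by case=> [[[]//|i]|[[]//]]; rewrite ffunE /= nth_pm_rev.
apply: planar_flat2; [exact: cup_mateK|exact: cup_mate_neq|].
by rewrite !card_sum card_prod !card_ord.
Qed.

Lemma cap_basis : is_basis capweb.
Proof.
apply: is_basis_flat; [exact: cap_mateK| | |by []]; last first.
  by case=> [[i|[]//]|[[]//]]; rewrite ffunE /= nth_pm_rev.
apply: planar_flat2; [exact: cap_mateK|exact: cap_mate_neq|].
by rewrite !card_sum card_prod !card_ord.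
Qed.

Lemma capcup_basis : is_basis capcup.
Proof.
apply: is_basis_flat; [exact: capcup_mateK| | |by []]; last first.
  by case=> [[i|i]|[[]//]]; rewrite ffunE /= nth_pm_rev // negbK.
pose B (i : 'I_2) : hedge pm pm 'I_0 := inl (inl i).
pose T (i : 'I_2) : hedge pm pm 'I_0 := inl (inr i).
apply: (planar_flat capcup_mateK capcup_mate_neq (T ord0)).
have T4 : #|hedge pm pm 'I_0| = 4%N by rewrite !card_sum card_prod !card_ord.
have TP (x : hedge pm pm 'I_0) :
    [\/ x = B ord0, x = B ord_max, x = T ord0 | x = T ord_max].
  by case: x => [[[[|[|//]] i]|[[|[|//]] i]]|[[]//]];
    [apply: Or41|apply: Or42|apply: Or43|apply: Or44];
    rewrite /B /T; (congr (inl (inl _)) || congr (inl (inr _))); apply: val_inj.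
have bE : boundary pm pm = [:: inr ord0; inr ord_max; inl ord_max; inl ord0].
  have E : enum 'I_2 = [:: ord0; ord_max].
    by apply: (inj_map val_inj); rewrite val_enum_ord.
  by rewrite /boundary /= E.
have r0 : rev_ord (ord0 : 'I_2) = ord_max by apply: val_inj.
have r1 : rev_ord (ord_max : 'I_2) = ord0 by apply: val_inj.
have fE : (face_step capcup (T ord0) = B ord_max)
  * (face_step capcup (T ord_max) = T ord_max)
  * (face_step capcup (B ord0) = B ord0)
  * (face_step capcup (B ord_max) = T ord0).
  by rewrite /face_step /T /B !ffunE r0 r1 /turn bE.
(* There are three faces for two edges: each arc cuts off a face with one half-edge, and the face
   between the arcs has the two half-edges that [rep] merges. *)
pose rep x := if x == B ord_max then T ord0 else x.
have f_inj : injective (face_step capcup).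
  by apply: inj_comp; [exact: turn_flat_inj|exact: inv_inj capcup_mateK].
rewrite T4 (n_compE (rep := rep)).
- rewrite (_ : [set _ | x in _] = [set~ B ord_max]).
    by rewrite cardsC1 T4.
  apply/setP=> y; rewrite !inE; apply/imsetP/idP.
    by case=> x _ ->; case: (TP x) => ->; rewrite /rep.
  by move=> yB; exists y; rewrite // /rep (negbTE yB).
- exact: fconnect_sym.
- by move=> x y /eqP<-; case: (TP x) => ->; rewrite fE.
move=> x; rewrite /rep; case: eqP => [->|_]; last exact: connect0.
by apply: connect1; rewrite /= fE.
Qed.

(** * Stacks whose middle level closes up to a circle *)

Section CircleStack.
Variables (c d : word) (g : preweb pm d 'I_0) (f : preweb c pm 'I_0).
Variables (w : preweb c d 'I_0).
Variables (bs : 'I_(size c) -> 'I_(size c)) (ts : 'I_(size d) -> 'I_(size d)).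
Hypotheses (gK : involutive (mate g)) (fK : involutive (mate f)).
Hypotheses (wK : involutive (mate w)) (w_neq : forall x, mate w x != x).
Hypothesis g_bot : forall i, mate g (@bbot pm d 'I_0 i) = @bbot pm d 'I_0 (rev_ord i).
Hypothesis f_top : forall i, mate f (@btop c pm 'I_0 i) = @btop c pm 'I_0 (rev_ord i).
Hypothesis f_bot : forall i, mate f (bbot pm _ i) = bbot pm _ (bs i).
Hypothesis w_bot : forall i, mate w (bbot d _ i) = bbot d _ (bs i).
Hypothesis g_top : forall i, mate g (btop pm _ i) = btop pm _ (ts i).
Hypothesis w_top : forall i, mate w (btop c _ i) = btop c _ (ts i).

(* The four middle half-edges form one closed loop. *)
Lemma stack_circle : web_sim (stack g f) w /\
  loops (stack g f) = (1 + (loops g + loops f))%N.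
Proof.
(* Outer half-edges keep their name and middle ones get [None]. Gluing changes a label at most by
   [mate w], so the circle never meets the outer arcs. *)
pose lab (x : hedge c pm 'I_0 + hedge pm d 'I_0) : option (hedge c d 'I_0) :=
  match x with
  | inl (inl (inl i)) => Some (bbot d _ i)
  | inr (inl (inr j)) => Some (btop c _ j)
  | _ => None
  end.
set G := glue (stack_mate g f) (@stack_arc c pm d 'I_0 'I_0).
have labG x y : G x y -> lab y = lab x \/ lab y = omap (mate w) (lab x).
  case/orP=> [/eqP<-|].
    case: x => [[[i|i]|[[]//]]|[[i|i]|[[]//]]] /=.
    - by right; rewrite -/(bbot _ _ _) f_bot /= w_bot.
    - by left; rewrite -/(btop _ _ _) f_top.
    - by left; rewrite -/(bbot _ _ _) g_bot.
    - by right; rewrite -/(btop _ _ _) g_top /= w_top.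
  by case: x => [[[x|x]|[[]//]]|[[x|x]|[[]//]]];
    case: y => [[[y|y]|[[]//]]|[[y|y]|[[]//]]] //= _; left.
have labK u : lab (flat_kept pm u) = Some u by case: u => [[i|i]|[[]//]].
have labC t u : lab t = Some u -> connect G (flat_kept pm u) t.
  by case: t => [[[i|i]|[[]//]]|[[i|i]|[[]//]]] //= [<-].
have keptN u : connect G (flat_kept pm u) (flat_kept pm (mate w u)).
  case: u => [[i|i]|[[]//]]; rewrite -?/(bbot _ _ _) -?/(btop _ _ _) ?w_bot ?w_top;
    by apply: connect1; rewrite /G /glue /= -?/(bbot _ _ _) -?/(btop _ _ _)
      ?f_bot ?g_top eqxx.
split; first exact: (stack_flat wK w_neq labG labK keptN).
have midE (i j : 'I_2) : i != j -> rev_ord i = j.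
  by case: i j => [[|[|[]//]] ?] [[|[|[]//]] ?] //= _; apply: val_inj.
have topN (i : 'I_2) : connect G (inl (@btop c pm 'I_0 ord0)) (inl (@btop c pm 'I_0 i)).
  have [->|i0] := eqVneq i ord0; first exact: connect0.
  by apply: connect1; apply/orP; left; rewrite /= f_top (midE _ i) // eq_sym.
apply: (@stack_flat1 _ _ _ g f w lab gK fK wK labG labK _ (inl (@btop c pm 'I_0 ord0))).
- by move=> t u /labC; left.
- move=> t; split=> [|/(lab_connect wK labG)[]->//].
  case: t => [[[i|i]|[[]//]]|[[i|i]|[[]//]]] //= _; first exact: topN.
  by apply: connect_trans (topN i) (connect1 _); rewrite /G /glue /= eqxx ?orbT.
move=> [[[i|i]|[[]//]]|[[i|i]|[[]//]]] //= _.
  by exists (inr (@bbot pm d 'I_0 i)) => /=.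
by exists (inl (@btop c pm 'I_0 i)) => /=.
Qed.
End CircleStack.

(** * Juxtaposition of identity webs *)

Lemma juxtapose_id e1 e2 :
  web_sim (juxtapose (idweb e1) (idweb e2)) (idweb (e1 ++ e2)).
Proof.
exists (flat (c := e1 ++ e2) (d := e1 ++ e2)); split.
- by exists (unflat (c := e1 ++ e2) (d := e1 ++ e2)); [apply: flatK|apply: unflatK].
- by [].
- by case=> [p|[[[]|[]]]].
- by case=> [[i|j]|[[[]|[]]]].
(* Each position comes from the left or the right word, which excludes the default branch of [mate]
   in [juxtapose]. *)
have posP (i : 'I_(size (e1 ++ e2))) :
    (exists j, i = lpos e2 j) \/ (exists j, i = rpos e1 j).
  have := splitP (cast_ord (size_cat e1 e2) i) => -[j|j] E; [left|right];
    by exists j; apply: val_inj; rewrite /= -E.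
case=> [[i|i]|[[[]|[]] //]]; rewrite /= !ffunE /=.
- case: pickP => [[[j|j]|[[]//]] /= /eqP// [<-]|L]; first by rewrite ffunE.
  case: pickP => [[[j|j]|[[]//]] /= /eqP// [<-]|R]; first by rewrite ffunE.
  case: (posP i) => -[j E]; first by have := L (inl (inl j)); rewrite /= E eqxx.
  by have := R (inl (inl j)); rewrite /= E eqxx.
- case: pickP => [[[j|j]|[[]//]] /= /eqP// [<-]|L]; first by rewrite ffunE.
  case: pickP => [[[j|j]|[[]//]] /= /eqP// [<-]|R]; first by rewrite ffunE.
  case: (posP i) => -[j E]; first by have := L (inl (inr j)); rewrite /= E eqxx.
  by have := R (inl (inr j)); rewrite /= E eqxx.
Qed.

(** * Products of webs and of the clasp in the spider *)

Section Spider.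
Variables (K : fieldType) (v : K).

(** [tensor] works on the representatives chosen by [repr]; for a basis web on ['I_0] that
    representative is the web itself, by [flat_repr]. *)
Lemma tensor_flat e1 d1 e2 d2 (g : preweb e1 d1 'I_0) (f : preweb e2 d2 'I_0) :
  loops g = 0%N -> loops f = 0%N -> is_basis g -> is_basis f ->
  tensor v (reduct v g) (reduct v f) = reduct v (juxtapose g f).
Proof.
move=> g0 f0 /basis_flat[b gb] /basis_flat[b' fb'].
rewrite (reduct_flat _ _ gb) ?(reduct_flat _ _ fb'); try by case.
rewrite g0 f0 !expr0 !scale1r /tensor /bilin /basis_vec !linextU /bw.
by rewrite (flat_repr g0 gb) (flat_repr f0 fb').
Qed.

Lemma tensor_id e1 e2 : is_basis (idweb e1) -> is_basis (idweb e2) ->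
  tensor v (idhom v e1) (idhom v e2) = idhom v (e1 ++ e2).
Proof.
move=> B1 B2; rewrite /idhom tensor_flat //.
rewrite (reduct_sim (n := 0) v no_vertex2 no_vertex (juxtapose_id e1 e2)) //.
by rewrite expr0 scale1r.
Qed.

Lemma comp_basisE c e d (g : preweb e d 'I_0) (f : preweb c e 'I_0)
    (w : preweb c d 'I_0) n :
  is_basis g -> is_basis f -> loops w = 0%N ->
  web_sim (stack g f) w /\ loops (stack g f) = n ->
  hcomp v (reduct v g) (reduct v f) = qint v 3 ^+ n *: reduct v w.
Proof.
move=> Bg Bf w0 [S L]; have [[_ g0 _] [_ f0 _]] := (Bg, Bf).
have [[b gb] [b' fb']] := (basis_flat Bg, basis_flat Bf).
exact: (comp_flatE v g0 f0 w0 gb fb' S L).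
Qed.

Lemma comp_idl c e (w : preweb c e 'I_0) : is_basis (idweb e) -> is_basis w ->
  (forall x, mate w x != x) -> hcomp v (idhom v e) (reduct v w) = reduct v w.
Proof.
move=> Be Bw w_neq; have [[wK _ _] w0 _] := Bw; have := stack_idl wK w_neq.
by rewrite w0 => /(comp_basisE Be Bw w0)->; rewrite expr0 scale1r.
Qed.

Lemma comp_idr c e (w : preweb c e 'I_0) : is_basis (idweb c) -> is_basis w ->
  (forall x, mate w x != x) -> hcomp v (reduct v w) (idhom v c) = reduct v w.
Proof.
move=> Bc Bw w_neq; have [[wK _ _] w0 _] := Bw; have := stack_idr wK w_neq.
by rewrite w0 => /(comp_basisE Bw Bc w0)->; rewrite expr0 scale1r.
Qed.

Lemma cup_capE : hcomp v (cup v) (cap v) = reduct v capcup.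
Proof.
rewrite (comp_basisE cup_basis cap_basis (w := capcup) erefl stack_cup_cap).
by rewrite expr0 scale1r.
Qed.

Lemma cap_cupE : hcomp v (cap v) (cup v) = qint v 3 *: idhom v [::].
Proof.
rewrite (comp_basisE (n := 1) cap_basis cup_basis (w := idweb [::])) //.
(* Both outer words are empty, so [bs] and [ts] are maps on ['I_0]. *)
apply: (stack_circle (bs := id) (ts := id)); try by case.
- exact: cap_mateK.
- exact: cup_mateK.
- exact: idweb_mateK.
- exact: idweb_mate_neq.
- by move=> i; rewrite ffunE.
- by move=> i; rewrite ffunE.
Qed.

Lemma capcup_cupE : hcomp v (reduct v capcup) (cup v) = qint v 3 *: cup v.
Proof.
rewrite (comp_basisE (n := 1) capcup_basis cup_basis (w := cupweb)) //.
(* The top arc of [capcup] survives, whence [rev_ord] for [ts]. *)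
apply: (@stack_circle [::] pm capcup cupweb cupweb id (@rev_ord 2));
  try by [case|move=> i; rewrite ffunE].
- exact: capcup_mateK.
- exact: cup_mateK.
- exact: cup_mateK.
- exact: cup_mate_neq.
Qed.

Lemma cap_capcupE : hcomp v (cap v) (reduct v capcup) = qint v 3 *: cap v.
Proof.
rewrite (comp_basisE (n := 1) cap_basis capcup_basis (w := capweb)) //.
apply: (@stack_circle pm [::] capweb capcup capweb (@rev_ord 2) id);
  try by [case|move=> i; rewrite ffunE].
- exact: cap_mateK.
- exact: capcup_mateK.
- exact: cap_mateK.
- exact: cap_mate_neq.
Qed.

Local Notation "g '**' f" := (hcomp v g f) (at level 40, left associativity).

Lemma compZl c e d a (g : Defs.hom K e d) (f : Defs.hom K c e) :
  (a *: g) ** f = a *: (g ** f).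
Proof. by rewrite -[a *: g]addr0 compPl comp0l addr0. Qed.

Lemma compZr c e d a (g : Defs.hom K e d) (f : Defs.hom K c e) :
  g ** (a *: f) = a *: (g ** f).
Proof. by rewrite -[a *: f]addr0 compPr comp0r addr0. Qed.

(** This is the shape to which the linearity lemmas [compPl] and [compPr] apply. *)
Lemma claspE : clasp v = - (qint v 3)^-1 *: (cup v ** cap v) + idhom v pm.
Proof. by rewrite /clasp scaleNr addrC. Qed.

Lemma clasp_cup : qint v 3 != 0 -> clasp v ** cup v = 0.
Proof.
move=> q3; rewrite claspE compPl cup_capE capcup_cupE /cup.
rewrite (comp_idl idpm_basis cup_basis cup_mate_neq) scalerA mulNr mulVf //.
by rewrite scaleN1r addNr.
Qed.

Lemma cap_clasp : qint v 3 != 0 -> cap v ** clasp v = 0.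
Proof.
move=> q3; rewrite claspE compPr cup_capE cap_capcupE /cap.
rewrite (comp_idr idpm_basis cap_basis cap_mate_neq) scalerA mulNr mulVf //.
by rewrite scaleN1r addNr.
Qed.

Lemma comp_clasp_id : clasp v ** idhom v pm = clasp v.
Proof.
rewrite claspE compPl cup_capE idhom_idem.
by rewrite (comp_idr idpm_basis capcup_basis capcup_mate_neq).
Qed.

Lemma comp_id_clasp : idhom v pm ** clasp v = clasp v.
Proof.
rewrite claspE compPr cup_capE idhom_idem.
by rewrite (comp_idl idpm_basis capcup_basis capcup_mate_neq).
Qed.

(** * Splitting an object of the Karoubi envelope into two summands *)

Lemma kid_diag (D : kar v) i : kid (A := D) i i = kidem (summand i).
Proof. by rewrite /kid; case: eqP => // E; rewrite eq_axiomK. Qed.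

Lemma kid_off (D : kar v) (i j : 'I_(size D)) : j != i -> kid i j = 0.
Proof. by rewrite /kid; case: eqP => // ->; rewrite eqxx. Qed.

Section Split.
Variables A B C : kobj v.
Variables (p : Defs.hom K (kword A) (kword B)) (q : Defs.hom K (kword A) (kword C)).
Variables (r : Defs.hom K (kword B) (kword A)) (s : Defs.hom K (kword C) (kword A)).

(** Case analysis on the indices, closed by [Defined], makes the entries compute at concrete
    ordinals; out-of-range cases are filled with 0. *)
Definition split_mx : kmatrix [:: A] [:: B; C].
Proof.
move=> [[|[|i]] ilt] [[|j] jlt].
- exact: p.
- exact: 0.
- exact: q.
all: exact: 0.
Defined.

Definition merge_mx : kmatrix [:: B; C] [:: A].
Proof.
move=> [[|i] ilt] [[|[|j]] jlt].
- exact: r.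
- exact: s.
all: exact: 0.
Defined.

(** The biproduct criterion, with the idempotents serving as identities. *)
Lemma kiso_split :
  kidem B ** p ** kidem A = p -> kidem C ** q ** kidem A = q ->
  kidem A ** r ** kidem B = r -> kidem A ** s ** kidem C = s ->
  r ** p + s ** q = kidem A ->
  p ** r = kidem B -> p ** s = 0 -> q ** r = 0 -> q ** s = kidem C ->
  kiso [:: A] [:: B; C].
Proof.
move=> hp hq hr hs sum pr ps qr qs; exists split_mx, merge_mx.
(* Once the indices are closed ordinals, the matrix entries reduce and the conditions become the
   hypotheses. *)
have I1 (i : 'I_1) : i = Ordinal (isT : 0 < 1)%N by apply: val_inj; case: i => -[].
have I2 (i : 'I_2) : i = Ordinal (isT : 0 < 2)%N \/ i = Ordinal (isT : 1 < 2)%N.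
  by case: i => -[|[|[]//]] ?; [left|right]; apply: val_inj.
split.
- by move=> i j; rewrite (I1 j); case: (I2 i) => ->.
- by move=> i j; rewrite (I1 i); case: (I2 j) => ->.
- move=> i j; rewrite (I1 i) (I1 j) kid_diag /kcomp !big_ord_recl big_ord0 addr0.
  exact: sum.
move=> i j; rewrite /kcomp big_ord_recl big_ord0 addr0.
by case: (I2 i) => ->; case: (I2 j) => ->; rewrite ?kid_diag ?kid_off.
Qed.
End Split.

(** * The relation in the Grothendieck ring *)

Lemma kobj_eq e (h1 h2 : Defs.hom K e e) E1 E2 : h1 = h2 ->
  @KObj _ v e h1 E1 = @KObj _ v e h2 E2.
Proof. by move=> h12; case: _ / h12 in E2 *; congr KObj; apply: Prop_irrelevance. Qed.

Lemma kclass_clasp (q3 : qint v 3 != 0) :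
  kclass [:: id_obj v [:: true]] * kclass [:: id_obj v [:: false]] =
  kclass [:: clasp_obj q3] + 1.
Proof.
have <- : kclass [:: id_obj v pm] =
    kclass [:: id_obj v [:: true]] * kclass [:: id_obj v [:: false]].
  rewrite /kclass [RHS]K0_mulE; apply/keqP/keq_tensor.
  apply: List.Forall2_cons; last exact: List.Forall2_nil.
  have T := tensor_id (idweb1_basis true) (idweb1_basis false).
  have Tid : hcomp v (tensor v (idhom v [:: true]) (idhom v [:: false]))
      (tensor v (idhom v [:: true]) (idhom v [:: false])) =
    tensor v (idhom v [:: true]) (idhom v [:: false]) by rewrite T idhom_idem.
  (* [KTensor1] yields an object whose idempotent is literally a [tensor]; it equals [id_obj v pm]
     by proof irrelevance. *)
  rewrite /= (_ : id_obj v pm = @KObj _ v pm _ Tid); first exact: KTensor1.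
  exact/kobj_eq/esym.
have -> : (1 : K0 v) = kclass [:: id_obj v [::]] by apply/esym/keqP/keq_unit.
rewrite [RHS]K0_addE -(keqP (keq_sum [:: _] [:: _])); apply/keqP/keq_iso.
(* With 1/[3] on the cap alone, cap after cup gives the identity, and cup after cap gives exactly
   the term subtracted in [clasp]. *)
apply: (@kiso_split (id_obj v pm) (clasp_obj q3) (id_obj v [::]) (clasp v)
  ((qint v 3)^-1 *: cap v) (clasp v) (cup v)) => /=.
- by rewrite clasp_idem // comp_clasp_id.
- rewrite compZr compZl {1 2}/cap (comp_idl idweb0_basis cap_basis cap_mate_neq).
  by rewrite (comp_idr idpm_basis cap_basis cap_mate_neq).
- by rewrite comp_id_clasp clasp_idem.
- rewrite {1 2}/cup (comp_idl idpm_basis cup_basis cup_mate_neq).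
  by rewrite (comp_idr idweb0_basis cup_basis cup_mate_neq).
- by rewrite clasp_idem // compZr /clasp subrK.
- exact: clasp_idem.
- exact: clasp_cup.
- by rewrite compZl cap_clasp // scaler0.
- by rewrite compZl cap_cupE scalerA mulVf // scale1r.
Qed.
End Spider.

Theorem proposition3p6 (R : realType) :
  let X : K0 (q16 R) := kclass [:: id_obj (q16 R) [:: true]] in
  let Y : K0 (q16 R) := kclass [:: id_obj (q16 R) [:: false]] in
  let P11 : K0 (q16 R) := kclass [:: clasp_obj (qint3_neq0 R)] in
  P11 = X * Y - 1.
Proof. by move=> X Y P11; rewrite /X /Y (kclass_clasp (qint3_neq0 R)) addrK. Qed.
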